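(* Let $n \geq 1$ be an integer. Let $A_{2n}$ be the set of permutations of $[2n]=\{1,2,\ldots,2n\}$ all of whose cycles are odd, and let $P_{2n}$ be the set of permutations of $[2n]$ such that the cycle containing the element $1$ is even and all other cycles are odd. Then there exists a bijection between $A_{2n}$ and $P_{2n}$.
   Context: Permutations are considered through their decomposition into disjoint cycles, where fixed points count as cycles of length $1$. A cycle is called odd (respectively even) if its length, i.e. the number of elements it contains, is odd (respectively even). *)

(* Defs.v *)
From mathcomp Require Import all_boot all_fingroup.
Set Implicit Arguments.
Unset Strict Implicit.
Unset Printing Implicit Defensive.

(* The cycles of s, fixed points included, are the elements of porbits s;
   the cycle of x is porbit s x, and the length of a cycle is its cardinal. *)

Definition all_cycles_odd (m : nat) : {set 'S_m} :=
  [set s : 'S_m | [forall C in porbits s, odd #|C| ]].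

Definition cycle_even_others_odd (m : nat) (x : 'I_m) : {set 'S_m} :=
  [set s : 'S_m | ~~ odd #|porbit s x|
                & [forall C in porbits s, (C != porbit s x) ==> odd #|C| ]].

Lemma mul2n_gt0 (n : nat) : 1 <= n -> 0 < 2 * n.
Proof. by rewrite muln_gt0. Qed.

(* [2n] is 'I_(2 * n), counted from 0, so the element 1 of [2n] is the ordinal
   of value 0. *)
Definition elt1 (n : nat) (hn : 1 <= n) : 'I_(2 * n) :=
  Ordinal (mul2n_gt0 hn).

(* Main.v *)
Require Import Defs.
From mathcomp Require Import all_boot all_fingroup.
Set Implicit Arguments.
Unset Strict Implicit.
Unset Printing Implicit Defensive.

(** Both sets are finite, so it is enough to show that they have the same
    number of elements. For a finite set A, let O(A) be the number of
    permutations of A whose cycles are all odd and, for x in A, let P(A, x) be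
    the number of those in which the cycle of x is even and every other cycle
    is odd.

    Take x outside A. A permutation of A together with x either fixes x or
    arises from a permutation u of A by inserting x just after some z in A, in
    the cycle of z; z and u are determined by the result. Insertion lengthens
    the cycle of z by one, so changes its parity, and leaves the other cycles
    alone. Hence, with A + x for A with x adjoined ([card_odd_except_perms],
    [card_odd_perms]),
<<
      P(A + x, x) = |A| O(A)
      O(A + x)    = O(A) + sum over z in A of P(A, z)
>>
    The first identity, applied to A - z, turns the sum in the second one into
    |A| - 1 times the sum of O(A - z) over z in A. By induction on |A| this
    gives ([card_odd_perms_setU1])
<<
      O(A + x) = |A| O(A)         if |A| is odd,
      O(A + x) = (|A| + 1) O(A)   if |A| is even.
>>
    When A is [2n] without the element 1, which has odd size, O(A + x) and
    P(A + x, x) are therefore both equal to |A| O(A). *)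

(** * Cycles of a permutation *)

Section OddCycles.

Variable T : finType.
Implicit Types (A D : {set T}) (s u : {perm T}) (x y z w : T).

Lemma porbit_fixed s x : s x = x -> porbit s x = [set x].
Proof.
move=> sx; apply/setP=> w; rewrite inE; apply/porbitP/eqP=> [[i ->]|->].
  by rewrite permX iter_fix.
by exists 0; rewrite expg0 perm1.
Qed.

Lemma porbit_step s x y : y \in porbit s x -> s y \in porbit s x.
Proof. by case/porbitP=> i ->; rewrite -permM -expgSr mem_porbit. Qed.

Lemma porbit_sub_closed s D y :
  y \in D -> {in D, forall w, s w \in D} -> porbit s y \subset D.
Proof.
move=> Dy Ds; apply/subsetP=> w /porbitP[i ->].
by elim: i => [|i IHi]; rewrite ?expg0 ?perm1 // expgSr permM Ds.
Qed.

Lemma eq_porbit_in s u y :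
  {in porbit u y, forall w, s w = u w} -> porbit s y = porbit u y.
Proof.
move=> eq_su.
have eqX i : (s ^+ i)%g y = (u ^+ i)%g y.
  elim: i => [|i IHi]; first by rewrite !expg0.
  by rewrite !expgSr !permM IHi eq_su ?mem_porbit.
by apply/setP=> w; apply/porbitP/porbitP=> -[i ->]; exists i; rewrite eqX.
Qed.

(** Parity is tested on the cycle of every point rather than on every member
    of [porbits s]: the points fixed by [s] satisfy the test for free, so a
    permutation of a subset [A] can be handled as a permutation of [T] with
    support in [A]. *)
Definition all_odd s := [forall y, odd #|porbit s y|].

Definition odd_except x s :=
  ~~ odd #|porbit s x| &&
  [forall y, (y \notin porbit s x) ==> odd #|porbit s y|].

Definition odd_perms A := [set s | perm_on A s & all_odd s].

Definition odd_except_perms A x := [set s | perm_on A s & odd_except x s].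

(** * Inserting a point into a cycle *)

Section Insertion.

Variables (u : {perm T}) (x z : T).
Hypotheses (ux : u x = x) (neq_xz : x != z).
(* As [(f * g)%g] applies [f] first, [s] sends [z] to [x] and [x] to [u z]:
   the point [x] is inserted just after [z]. *)
Let s := (tperm x z * u)%g.

Let sz : s z = x. Proof. by rewrite permM tpermR. Qed.
Let sx : s x = u z. Proof. by rewrite permM tpermL. Qed.
Let sD y : y != x -> y != z -> s y = u y.
Proof. by move=> yx yz; rewrite permM tpermD // eq_sym. Qed.

Lemma porbit_insert : porbit s x = x |: porbit u z.
Proof.
apply/eqP; rewrite eqEsubset; apply/andP; split.
  apply: porbit_sub_closed => [|w]; first exact: setU11.
  case: (eqVneq w x) => [-> _|wx].
    by rewrite sx; apply/setU1r/porbit_step/porbit_id.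
  case: (eqVneq w z) => [-> _|wz]; first by rewrite sz setU11.
  by rewrite !inE (negPf wx) /= sD // => /porbit_step->; rewrite orbT.
have zx : z \in porbit s x by rewrite porbit_sym -{1}sz; apply/porbit_step/porbit_id.
rewrite subUset sub1set porbit_id; apply: porbit_sub_closed => // w wx.
case: (eqVneq w x) => [->|nwx]; first by rewrite ux porbit_id.
case: (eqVneq w z) => [->|nwz]; first by rewrite -sx; apply/porbit_step/porbit_id.
by rewrite -sD // porbit_step.
Qed.

Lemma card_porbit_insert : #|porbit s x| = #|porbit u z|.+1.
Proof.
by rewrite porbit_insert cardsU1 porbit_sym porbit_fixed // inE eq_sym neq_xz.
Qed.

Lemma porbit_outside_insert y :
  y \notin porbit s x -> porbit s y = porbit u y.
Proof.
rewrite porbit_insert !inE negb_or => /andP[yx yz].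
apply: eq_porbit_in => w wy; apply: sD.
  apply: contraNneq yx => wx.
  by move: wy; rewrite wx porbit_sym porbit_fixed ?inE.
by apply: contraNneq yz => wz; rewrite porbit_sym -wz.
Qed.

Lemma odd_except_insert : odd_except x s = all_odd u.
Proof.
rewrite /odd_except card_porbit_insert /= negbK.
apply/andP/forallP=> [[oz /forallP odd_s] y|odd_u].
  have [yz|yz] := boolP (y \in porbit u z).
    by move: yz; rewrite -eq_porbit_mem => /eqP->.
  case: (eqVneq y x) => [->|yx]; first by rewrite porbit_fixed ?cards1.
  have ys : y \notin porbit s x by rewrite porbit_insert !inE negb_or yx.
  by have := odd_s y; rewrite ys porbit_outside_insert.
split=> //; apply/forallP=> y; apply/implyP=> ys.
by rewrite porbit_outside_insert.
Qed.

Lemma all_odd_insert : all_odd s = odd_except z u.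
Proof.
apply/forallP/andP=> [odd_s|[ez /forallP odd_u] y].
  split; first by have := odd_s x; rewrite card_porbit_insert.
  apply/forallP=> y; apply/implyP=> yz.
  case: (eqVneq y x) => [->|yx]; first by rewrite porbit_fixed ?cards1.
  by rewrite -porbit_outside_insert // porbit_insert !inE negb_or yx.
have [ys|ys] := boolP (y \in porbit s x).
  by move: ys; rewrite -eq_porbit_mem => /eqP->; rewrite card_porbit_insert.
rewrite porbit_outside_insert //; apply: implyP (odd_u y) _.
by move: ys; rewrite porbit_insert inE negb_or => /andP[].
Qed.

End Insertion.

(** * Counting by insertion *)

(** Sort the permutations [s] of [x |: A] by the point [z] that [s] sends to
    [x]; left multiplication by [tperm x z], which is trivial if [z = x],
    is a bijection onto them from the permutations of [A]. *)
Lemma card_perm_insert A x (Q : pred {perm T}) (R : T -> pred {perm T}) :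
    x \notin A ->
    (forall z u, u x = x -> Q (tperm x z * u)%g = R z u) ->
  #|[set s | perm_on (x |: A) s & Q s]| =
    \sum_(z in x |: A) #|[set u | perm_on A u & R z u]|.
Proof.
move=> xA QR; rewrite -sum1_card.
rewrite (partition_big (fun s => (s^-1)%g x) [in x |: A]) /=; last first.
  move=> s; rewrite inE => /andP[/perm_onV onV _].
  by rewrite perm_closed // setU11.
apply: eq_bigr => z zA; rewrite sum1dep_card.
rewrite -[RHS](card_imset _ (mulgI (tperm x z))).
apply: eq_card => s; apply/idP/imsetP=> [|[u + ->]].
  rewrite !inE => /andP[/andP[onS Qs] /eqP def_z].
  pose u := (tperm x z * s)%g.
  have def_s : s = (tperm x z * u)%g by rewrite mulgA tperm2 mul1g.
  have ux : u x = x by rewrite permM tpermL -def_z permKV.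
  exists u => //; rewrite inE -(QR z u ux) -def_s Qs andbT.
  have onU : perm_on (x |: A) u.
    apply: perm_onM onS; apply: subset_trans (tperm_on x z) _.
    by rewrite subUset !sub1set setU11.
  apply/subsetP=> w uw; have /setU1P[wx|//] := subsetP onU w uw.
  by move: uw; rewrite wx inE ux eqxx.
rewrite !inE => /andP[onU Ru]; have ux : u x = x by apply: out_perm onU xA.
rewrite QR // Ru andbT perm_onM /=.
- by rewrite -(inj_eq (@perm_inj _ (tperm x z * u)%g)) permKV permM tpermR ux.
- by apply: subset_trans (tperm_on x z) _; rewrite subUset !sub1set setU11.
- by apply: subset_trans onU _; apply: subsetUr.
Qed.

Lemma card_odd_except_perms A x : x \notin A ->
  #|odd_except_perms (x |: A) x| = #|A| * #|odd_perms A|.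
Proof.
move=> xA.
rewrite (card_perm_insert (R := fun z u => (x != z) && all_odd u)) //; last first.
  move=> z u ux; case: eqVneq => [<-|xz]; last exact: odd_except_insert.
  by rewrite tperm1 mul1g /odd_except porbit_fixed // cards1.
rewrite big_setU1 //= eqxx [X in X + _]eq_card0 ?add0n; last first.
  by move=> u; rewrite !inE andbF.
rewrite -sum_nat_const; apply: eq_bigr => z zA.
apply: eq_card => u; rewrite !inE.
by have -> : x != z by apply: contraNneq xA => ->.
Qed.

Lemma card_odd_perms A x : x \notin A ->
  #|odd_perms (x |: A)| =
    #|odd_perms A| + \sum_(z in A) #|odd_except_perms A z|.
Proof.
move=> xA.
pose R z u := if x == z then all_odd u else odd_except z u.
rewrite (card_perm_insert (R := R)) // /R; last first.
  move=> z u ux; case: eqVneq => [<-|xz]; last exact: all_odd_insert.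
  by rewrite tperm1 mul1g.
rewrite big_setU1 //= eqxx; congr (_ + _).
apply: eq_bigr => z zA; apply: eq_card => u; rewrite !inE.
by case: eqVneq => // xz; move: xA; rewrite xz zA.
Qed.

(** Let [z] range over [A]. Both [#|odd_except_perms A z|] and, by the induction
    hypothesis, [#|odd_perms A|] are multiples of [#|odd_perms (A :\ z)|]. The
    factors are both [#|A| - 1] if [#|A|] is even, and [#|A| - 1] and [#|A|] if
    [#|A|] is odd. So the sum in [card_odd_perms] is [#|A|], respectively
    [#|A| - 1], times [#|odd_perms A|]. *)
Lemma card_odd_perms_setU1 A x : x \notin A ->
  #|odd_perms (x |: A)| = (#|A| + ~~ odd #|A|) * #|odd_perms A|.
Proof.
have [m] := ubnP #|A|; elim: m A x => // m IHm A x leAm xA.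
rewrite card_odd_perms //.
have [->|[z0 z0A]] := set_0Vmem A.
  by rewrite big_set0 cards0 addn0 mul1n.
have [k cardA] : exists k, #|A| = k.+1.
  by exists #|A|.-1; rewrite prednK // card_gt0; apply/set0Pn; exists z0.
have step z : z \in A ->
    #|odd_perms A| = (k + ~~ odd k) * #|odd_perms (A :\ z)|
    /\ #|odd_except_perms A z| = k * #|odd_perms (A :\ z)|.
  move=> zA; have zAz : z \notin A :\ z by rewrite !inE eqxx.
  have cardAz : #|A :\ z| = k.
    by apply/eqP; rewrite -eqSS -cardA (cardsD1 z A) zA.
  have ltAz : #|A :\ z| < m by rewrite cardAz -ltnS -cardA.
  have:= IHm _ _ ltAz zAz; have:= card_odd_except_perms zAz.
  by rewrite setD1K // cardAz.
rewrite cardA /=; case odd_k: (odd k) step => step.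
  have -> : \sum_(z in A) #|odd_except_perms A z| = k.+1 * #|odd_perms A|.
    rewrite -cardA -sum_nat_const; apply: eq_bigr => z /step[-> ->].
    by rewrite addn0.
  by rewrite /= addn1 [RHS]mulSn.
have -> : \sum_(z in A) #|odd_except_perms A z| = k * #|odd_perms A|.
  (* Multiplied by [#|A|], every term of the sum becomes [k * #|odd_perms A|]. *)
  apply/eqP; rewrite -(eqn_pmul2l (ltn0Sn k)) -{2}cardA mulnCA.
  rewrite -sum_nat_const.
  rewrite !big_distrr; apply/eqP; apply: eq_bigr => z /step[-> ->].
  by rewrite /= addn1 mulnCA.
by rewrite /= addn0 mulSn.
Qed.

Lemma card_odd_perms_even A x : x \in A -> ~~ odd #|A| ->
  #|odd_perms A| = #|odd_except_perms A x|.
Proof.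
move=> xA; rewrite -(setD1K xA); have: x \notin A :\ x by rewrite !inE eqxx.
move: (A :\ x) => B xB; rewrite cardsU1 xB /= negbK => oddB.
by rewrite card_odd_perms_setU1 // card_odd_except_perms // oddB addn0.
Qed.

End OddCycles.

(** * The bijection *)

Lemma bij_of_card_eq (T1 T2 : finType) :
  #|T1| = #|T2| -> exists f : T1 -> T2, bijective f.
Proof.
move=> eqT; exists (fun x => enum_val (cast_ord eqT (enum_rank x))).
exists (fun y => enum_val (cast_ord (esym eqT) (enum_rank y))) => x.
  by rewrite enum_valK cast_ordK enum_rankK.
by rewrite enum_valK cast_ordKV enum_rankK.
Qed.

Lemma perm_onT (T : finType) (s : {perm T}) : perm_on setT s.
Proof. by apply/subsetP=> x _; rewrite inE. Qed.

Lemma all_cycles_oddE m : all_cycles_odd m = odd_perms [set: 'I_m].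
Proof.
apply/setP=> s; rewrite !inE perm_onT /=.
apply/forall_inP/forallP=> [odd_s y|odd_s C /imsetP[y _ ->]] //.
by apply: odd_s; apply: imset_f.
Qed.

Lemma cycle_even_others_oddE m (x : 'I_m) :
  cycle_even_others_odd x = odd_except_perms [set: 'I_m] x.
Proof.
apply/setP=> s; rewrite !inE perm_onT /=; congr (_ && _).
apply/forall_inP/forallP=> [odd_s y|odd_s C /imsetP[y _ ->]].
  by rewrite -eq_porbit_mem; apply: odd_s; apply: imset_f.
by rewrite eq_porbit_mem.
Qed.

Theorem theorem1p1 (n : nat) (hn : 1 <= n) :
  exists f : {s : 'S_(2 * n) | s \in all_cycles_odd (2 * n)} ->
             {s : 'S_(2 * n) | s \in cycle_even_others_odd (elt1 hn)},
    bijective f.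
Proof.
apply: bij_of_card_eq; rewrite !card_sig.
rewrite all_cycles_oddE cycle_even_others_oddE.
apply: card_odd_perms_even; first exact: in_setT.
by rewrite cardsT card_ord oddM.
Qed.
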